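(* For every formula $\varphi$ of the language $\mathcal{L}_{\forall\exists}$, \[ \mathsf{M^{+}IPC}\vdash\varphi \quad\text{iff}\quad \mathsf{M^{+}Grz}\vdash\varphi^t \quad\text{iff}\quad \mathsf{MGL}\vdash(\varphi^t)^s . \]
   Context: **Intuitionistic side.** $\mathcal{L}_{\forall\exists}$ is the propositional intuitionistic language ($\wedge,\vee,\to,\neg$ over countably many propositional letters) enriched with two unary modalities $\forall,\exists$ (these are propositional modalities, not quantifiers binding variables). $\mathsf{MIPC}$ is the smallest set of $\mathcal{L}_{\forall\exists}$-formulas containing all axioms of intuitionistic propositional logic $\mathsf{IPC}$; the formulas $\forall p\to p$, $\forall p\to\forall\forall p$, $\forall(p\wedge q)\leftrightarrow(\forall p\wedge\forall q)$, $\forall(p\to q)\to(\forall p\to\forall q)$; the formulas $p\to\exists p$, $\exists\exists p\to\exists p$, $\exists(p\vee q)\leftrightarrow(\exists p\vee\exists q)$, $\exists(\exists p\wedge q)\leftrightarrow(\exists p\wedge\exists q)$, $\forall(p\to q)\to(\exists p\to\exists q)$; and $\exists p\to\forall\exists p$, $\exists\forall p\to\forall p$; and closed under substitution, modus ponens, and $\forall$-necessitation (from $\varphi$ infer $\forall\varphi$). $\mathsf{M^{+}IPC}$ is the smallest set of formulas containing $\mathsf{MIPC}$ and \[\mathsf{MCas}:\quad \forall((p\to\forall p)\to\forall p)\to\forall p\] and closed under the same rules. **Modal side.** $\mathcal{ML}_\forall$ is the classical propositional language with two unary modalities $\Box$ and $\forall$; $\exists\varphi$ abbreviates $\neg\forall\neg\varphi$.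 $\mathsf{MK}$ is the smallest set of $\mathcal{ML}_\forall$-formulas containing all classical tautologies, $\Box(p\to q)\to(\Box p\to\Box q)$, the $\mathsf{S5}$-axioms for $\forall$ (namely $\forall p\to p$, $\forall p\to\forall\forall p$, $\neg\forall p\to\forall\neg\forall p$, $\forall(p\to q)\to(\forall p\to\forall q)$), and the bridge axiom $\Box\forall p\to\forall\Box p$, and closed under substitution, modus ponens, $\Box$-necessitation and $\forall$-necessitation. An mm-logic is an extension of $\mathsf{MK}$ closed under these rules. - $\mathsf{MGrz}$ is the least mm-logic containing $\Box p\to p$, $\Box p\to\Box\Box p$ and $\mathsf{grz}=\Box(\Box(p\to\Box p)\to p)\to p$. - $\mathsf{M^{+}Grz}$ is the least mm-logic containing $\mathsf{MGrz}$ and $\mathsf{M_\Box Cas}:\ \blacksquare\big(\Box(\Box p\to\blacksquare p)\to\blacksquare p\big)\to\blacksquare p$, where $\blacksquare\psi$ abbreviates $\Box\forall\psi$ (this formula is provably equivalent to $(\mathsf{MCas})^t$). - $\mathsf{MGL}$ is the least mm-logic containing $\mathsf{gl}=\Box(\Box p\to p)\to\Box p$. $\mathsf{L}\vdash\varphi$ means $\varphi\in\mathsf{L}$. **Gödel translation** $(-)^t:\mathcal{L}_{\forall\exists}\to\mathcal{ML}_\forall$: $p^t=\Box p$; $(\varphi\vee\psi)^t=\varphi^t\vee\psi^t$; $(\varphi\wedge\psi)^t=\varphi^t\wedge\psi^t$; $(\varphi\to\psi)^t=\Box(\varphi^t\to\psi^t)$; $(\neg\varphi)^t=\Box\neg\varphi^t$;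 $(\forall\varphi)^t=\Box\forall\varphi^t$; $(\exists\varphi)^t=\exists\varphi^t$. **Splitting translation** $(-)^s$ on $\mathcal{ML}_\forall$: $\varphi^s$ is the result of replacing every occurrence of $\Box$ in $\varphi$ by $\Box^{+}$, where $\Box^{+}\psi=\psi\wedge\Box\psi$ (propositional connectives and $\forall,\exists$ are left unchanged). *)

(* Defs.v *)
(** ** The intuitionistic bimodal language and its logics *)

(** As in the source, negation is primitive and there is no falsum constant;
    propositional letters are indexed by [nat]. *)
Inductive iform : Type :=
| IVar (n : nat)
| IAnd (A B : iform)
| IOr (A B : iform)
| IImp (A B : iform)
| INeg (A : iform)
| IAll (A : iform)
| IEx (A : iform).

Declare Scope iform_scope.
Delimit Scope iform_scope with iform.
Bind Scope iform_scope with iform.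
Notation "~ A" := (INeg A) : iform_scope.
Notation "A /\ B" := (IAnd A B) : iform_scope.
Notation "A \/ B" := (IOr A B) : iform_scope.
Notation "A ==> B" := (IImp A B) (at level 90, right associativity) : iform_scope.
Notation "A <==> B" := (IAnd (IImp A B) (IImp B A))
  (at level 95, no associativity) : iform_scope.

Fixpoint isubst (s : nat -> iform) (A : iform) : iform :=
  match A with
  | IVar n => s n
  | IAnd A B => IAnd (isubst s A) (isubst s B)
  | IOr A B => IOr (isubst s A) (isubst s B)
  | IImp A B => IImp (isubst s A) (isubst s B)
  | INeg A => INeg (isubst s A)
  | IAll A => IAll (isubst s A)
  | IEx A => IEx (isubst s A)
  end.

(** The smallest set of formulas containing [Ax] and closed under
    substitution, modus ponens and necessitation for the universal modality. *)
Inductive iclosure (Ax : iform -> Prop) : iform -> Prop :=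
| iclosure_ax A : Ax A -> iclosure Ax A
| iclosure_subst s A : iclosure Ax A -> iclosure Ax (isubst s A)
| iclosure_mp A B : iclosure Ax (A ==> B) -> iclosure Ax A -> iclosure Ax B
| iclosure_nec A : iclosure Ax A -> iclosure Ax (IAll A).

Section IntuitionisticAxioms.

Local Notation p := (IVar 0).
Local Notation q := (IVar 1).
Local Notation r := (IVar 2).

(** Axioms are stated for letters, since substitution is a rule. *)
Inductive IPC_ax : iform -> Prop :=
| IPC_K : IPC_ax (p ==> q ==> p)
| IPC_S : IPC_ax ((p ==> q ==> r) ==> (p ==> q) ==> p ==> r)
| IPC_andl : IPC_ax (p /\ q ==> p)
| IPC_andr : IPC_ax (p /\ q ==> q)
| IPC_and : IPC_ax (p ==> q ==> p /\ q)
| IPC_orl : IPC_ax (p ==> p \/ q)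
| IPC_orr : IPC_ax (q ==> p \/ q)
| IPC_or : IPC_ax ((p ==> r) ==> (q ==> r) ==> p \/ q ==> r)
| IPC_neg : IPC_ax ((p ==> q) ==> (p ==> ~ q) ==> ~ p)
| IPC_efq : IPC_ax (~ p ==> p ==> q).

Inductive MIPC_ax : iform -> Prop :=
| MIPC_IPC A : IPC_ax A -> MIPC_ax A
| MIPC_all_T : MIPC_ax (IAll p ==> p)
| MIPC_all_4 : MIPC_ax (IAll p ==> IAll (IAll p))
| MIPC_all_and : MIPC_ax (IAll (p /\ q) <==> IAll p /\ IAll q)
| MIPC_all_K : MIPC_ax (IAll (p ==> q) ==> IAll p ==> IAll q)
| MIPC_ex_T : MIPC_ax (p ==> IEx p)
| MIPC_ex_4 : MIPC_ax (IEx (IEx p) ==> IEx p)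
| MIPC_ex_or : MIPC_ax (IEx (p \/ q) <==> IEx p \/ IEx q)
| MIPC_ex_and : MIPC_ax (IEx (IEx p /\ q) <==> IEx p /\ IEx q)
| MIPC_all_ex_K : MIPC_ax (IAll (p ==> q) ==> IEx p ==> IEx q)
| MIPC_ex_all_ex : MIPC_ax (IEx p ==> IAll (IEx p))
| MIPC_ex_all : MIPC_ax (IEx (IAll p) ==> IAll p).

Definition MCas : iform := IAll ((p ==> IAll p) ==> IAll p) ==> IAll p.

End IntuitionisticAxioms.

Definition MIPC : iform -> Prop := iclosure MIPC_ax.

Definition MpIPC : iform -> Prop := iclosure (fun A => MIPC A \/ A = MCas).

(** ** The classical bimodal language and its logics *)

Inductive mform : Type :=
| MVar (n : nat)
| MAnd (A B : mform)
| MOr (A B : mform)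
| MImp (A B : mform)
| MNeg (A : mform)
| MBox (A : mform)
| MAll (A : mform).

Definition MEx (A : mform) : mform := MNeg (MAll (MNeg A)).

Definition MBoxAll (A : mform) : mform := MBox (MAll A).

Declare Scope mform_scope.
Delimit Scope mform_scope with mform.
Bind Scope mform_scope with mform.
Notation "~ A" := (MNeg A) : mform_scope.
Notation "A /\ B" := (MAnd A B) : mform_scope.
Notation "A \/ B" := (MOr A B) : mform_scope.
Notation "A ==> B" := (MImp A B) (at level 90, right associativity) : mform_scope.

Fixpoint msubst (s : nat -> mform) (A : mform) : mform :=
  match A with
  | MVar n => s n
  | MAnd A B => MAnd (msubst s A) (msubst s B)
  | MOr A B => MOr (msubst s A) (msubst s B)
  | MImp A B => MImp (msubst s A) (msubst s B)
  | MNeg A => MNeg (msubst s A)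
  | MBox A => MBox (msubst s A)
  | MAll A => MAll (msubst s A)
  end.

(** Boolean evaluation in which letters and formulas headed by a modality are
    atoms, with arbitrary truth values given by [v]. *)
Fixpoint beval (v : mform -> bool) (A : mform) : bool :=
  match A with
  | MAnd A B => andb (beval v A) (beval v B)
  | MOr A B => orb (beval v A) (beval v B)
  | MImp A B => implb (beval v A) (beval v B)
  | MNeg A => negb (beval v A)
  | MVar _ | MBox _ | MAll _ => v A
  end.

Definition tautology (A : mform) : Prop := forall v, beval v A = true.

(** The smallest set of formulas containing [Ax] and closed under
    substitution, modus ponens and both necessitation rules. *)
Inductive mclosure (Ax : mform -> Prop) : mform -> Prop :=
| mclosure_ax A : Ax A -> mclosure Ax A
| mclosure_subst s A : mclosure Ax A -> mclosure Ax (msubst s A)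
| mclosure_mp A B : mclosure Ax (A ==> B) -> mclosure Ax A -> mclosure Ax B
| mclosure_box A : mclosure Ax A -> mclosure Ax (MBox A)
| mclosure_all A : mclosure Ax A -> mclosure Ax (MAll A).

Section ModalAxioms.

Local Notation p := (MVar 0).
Local Notation q := (MVar 1).

Inductive MK_ax : mform -> Prop :=
| MK_taut A : tautology A -> MK_ax A
| MK_box_K : MK_ax (MBox (p ==> q) ==> MBox p ==> MBox q)
| MK_all_T : MK_ax (MAll p ==> p)
| MK_all_4 : MK_ax (MAll p ==> MAll (MAll p))
| MK_all_5 : MK_ax (~ MAll p ==> MAll (~ MAll p))
| MK_all_K : MK_ax (MAll (p ==> q) ==> MAll p ==> MAll q)
| MK_bridge : MK_ax (MBox (MAll p) ==> MAll (MBox p)).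

Definition box_T : mform := MBox p ==> p.

Definition box_4 : mform := MBox p ==> MBox (MBox p).

Definition grz : mform := MBox (MBox (p ==> MBox p) ==> p) ==> p.

Definition gl : mform := MBox (MBox p ==> p) ==> MBox p.

Definition MBoxCas : mform :=
  MBoxAll (MBox (MBox p ==> MBoxAll p) ==> MBoxAll p) ==> MBoxAll p.

End ModalAxioms.

Definition MK : mform -> Prop := mclosure MK_ax.

(** An mm-logic is an extension of [MK] closed under the rules of [mclosure],
    so this is the least mm-logic containing [Ax]. *)
Definition mmlogic (Ax : mform -> Prop) : mform -> Prop :=
  mclosure (fun A => MK A \/ Ax A).

Definition MGrz : mform -> Prop :=
  mmlogic (fun A => A = box_T \/ A = box_4 \/ A = grz).

Definition MpGrz : mform -> Prop := mmlogic (fun A => MGrz A \/ A = MBoxCas).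

Definition MGL : mform -> Prop := mmlogic (fun A => A = gl).

(** ** Translations *)

Fixpoint godel (A : iform) : mform :=
  match A with
  | IVar n => MBox (MVar n)
  | IAnd A B => MAnd (godel A) (godel B)
  | IOr A B => MOr (godel A) (godel B)
  | IImp A B => MBox (MImp (godel A) (godel B))
  | INeg A => MBox (MNeg (godel A))
  | IAll A => MBox (MAll (godel A))
  | IEx A => MEx (godel A)
  end.

Definition MBoxPlus (A : mform) : mform := MAnd A (MBox A).

Fixpoint splitting (A : mform) : mform :=
  match A with
  | MVar n => MVar n
  | MAnd A B => MAnd (splitting A) (splitting B)
  | MOr A B => MOr (splitting A) (splitting B)
  | MImp A B => MImp (splitting A) (splitting B)
  | MNeg A => MNeg (splitting A)
  | MBox A => MBoxPlus (splitting A)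
  | MAll A => MAll (splitting A)
  end.

(* Main.v *)
From Stdlib Require Import List Lia Classical ClassicalEpsilon Cantor.
Require Import Defs.
Import ListNotations.

(** The three conditions are linked in a cycle
    [MpIPC phi -> MpGrz (godel phi) -> MGL (splitting (godel phi)) -> MpIPC phi].

    The first two arrows are inductions on derivations. Translated formulas
    are stable ([A -> Box A] is provable, [stable_godel]), so that in a
    transitive reflexive logic the translated intuitionistic axioms become
    exercises with hypotheses that may be carried under [Box]. For the
    splitting translation, the axioms [grz] and [MBoxCas] follow from Loeb's
    rule in the form [MGL_loeb_boxplus]: to prove a boxed-plus conclusion one
    may assume its box. For [MBoxCas] this assumption collapses the formula to
    [All ((p -> All p) -> All p) -> All p], a theorem of S5 ([all_Cas]).

    The third arrow is a completeness argument: a formula that is not provable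
    in [MpIPC] is refuted, after both translations, in a frame for [MGL], that
    is, a frame whose transitive relation [R] is conversely well founded. The
    worlds are prime theories of [MpIPC]. A finite list [Sigma] of formulas
    contains the subformulas of the refuted formula, and a finite list [info]
    of modal formulas describes the clusters: which of the relevant formulas
    hold everywhere above, and which types (sets of formulas of [Sigma]) occur
    in the cluster. Both the type and the information grow along inclusion of
    theories. Two theories are put in the same cluster when they have the same
    information, and [R] demands a strict gain of information together with a
    growing type. Strict gains from a finite list can be iterated only
    finitely often, whence the converse well-foundedness; and as clusters
    know the types occurring in them, the bridge condition holds
    ([cluster_lift]).

    The price of strictness is that a refuted implication needs a witness with
    strictly more information. Therefore only saturated theories are worlds: a
    theory is saturated if no larger theory with the same information has a
    larger type. Every prime theory has a saturated extension with the same
    information ([saturation]), but the extension may contain a formula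
    that was to be refuted. The axiom [MCas] removes this obstacle
    ([saturated_refutation]): if [All q] fails, there is a theory above that
    contains [q -> All q] but not [All q]; since [All q] belongs to the
    information, it is not gained by saturating, and hence neither is [q]. *)

(** * Derivations in monadic modal logics *)

Definition two_letters (A B : mform) (n : nat) : mform :=
  match n with 0 => A | _ => B end.

(** Truth tables in which letters, boxed formulas and formula variables are
    the atoms. *)
Ltac taut :=
  intros v; unfold MEx, MBoxAll, MBoxPlus; cbn;
  repeat (match goal with
          | |- context [beval v ?X] => destruct (beval v X)
          | |- context [v ?X] => destruct (v X)
          end; cbn; try reflexivity); reflexivity.

(** Classes, so that the calculus below serves [MpGrz] and [MGL] alike without
    passing closure properties around. *)
Class is_mm_logic (L : mform -> Prop) : Prop := {
  mm_MK : forall A, MK A -> L A;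
  mm_subst : forall s A, L A -> L (msubst s A);
  mm_mp : forall A B, L (A ==> B)%mform -> L A -> L B;
  mm_box : forall A, L A -> L (MBox A);
  mm_all : forall A, L A -> L (MAll A) }.

Class contains_S4 (L : mform -> Prop) : Prop := {
  box_T_in : L box_T;
  box_4_in : L box_4 }.

Section ModalCalculus.

Context {L : mform -> Prop} {HL : is_mm_logic L}.

Local Notation "|- A" := (L A%mform) (at level 98).

Lemma thm_taut A : tautology A -> |- A.
Proof. intros H. apply mm_MK, mclosure_ax, MK_taut, H. Qed.

Lemma taut_mp1 A C : tautology (A ==> C) -> |- A -> |- C.
Proof. intros H. apply mm_mp, thm_taut, H. Qed.

Lemma taut_mp2 A B C : tautology (A ==> B ==> C) -> |- A -> |- B -> |- C.
Proof. intros H HA. apply mm_mp, (taut_mp1 A), HA. exact H. Qed.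

Lemma taut_mp3 A B C D :
  tautology (A ==> B ==> C ==> D) -> |- A -> |- B -> |- C -> |- D.
Proof. intros H HA HB. apply mm_mp, (taut_mp2 A B), HB; [exact H | exact HA]. Qed.

Lemma thm_and A B : |- A -> |- B -> |- A /\ B.
Proof. apply taut_mp2. taut. Qed.

Lemma MK_instance A B C : MK_ax C -> |- (msubst (two_letters A B) C).
Proof. intros H. apply mm_subst, mm_MK, mclosure_ax, H. Qed.

(** The calculus is applied to [MBox], [MAll], [MBoxAll] and [MBoxPlus], all
    of which satisfy necessitation and distribution over implication. *)
Record normal (N : mform -> mform) : Prop := {
  normal_nec : forall A, |- A -> |- N A;
  normal_K : forall A B, |- N (A ==> B) ==> N A ==> N B }.

Lemma normal_mono N A B : normal N -> |- A ==> B -> |- N A ==> N B.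
Proof.
  intros HN H. eapply mm_mp; [apply (normal_K N HN) | apply (normal_nec N HN), H].
Qed.

Lemma normal_mono2 N A B C :
  normal N -> |- A ==> B ==> C -> |- N A ==> N B ==> N C.
Proof.
  intros HN H. refine (taut_mp2 _ _ _ _ (normal_mono N _ _ HN H) (normal_K N HN B C)). taut.
Qed.

Lemma normal_taut N A B : normal N -> tautology (A ==> B) -> |- N A ==> N B.
Proof. intros HN H. apply normal_mono, thm_taut; assumption. Qed.

Lemma normal_taut2 N A B C :
  normal N -> tautology (A ==> B ==> C) -> |- N A ==> N B ==> N C.
Proof. intros HN H. apply normal_mono2, thm_taut; assumption. Qed.

Lemma normal_and N A B : normal N -> |- N A ==> N B ==> N (A /\ B).
Proof. intros HN. apply normal_taut2; [exact HN | taut]. Qed.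

Lemma normal_box : normal MBox.
Proof.
  split; intros.
  - now apply mm_box.
  - apply (MK_instance A B _ MK_box_K).
Qed.

Lemma normal_all : normal MAll.
Proof.
  split; intros.
  - now apply mm_all.
  - apply (MK_instance A B _ MK_all_K).
Qed.

Lemma normal_comp N M : normal N -> normal M -> normal (fun A => N (M A)).
Proof.
  intros HN HM. split; intros.
  - now apply (normal_nec N HN), (normal_nec M HM).
  - apply normal_mono2, (normal_K M HM). exact HN.
Qed.

Lemma normal_boxall : normal MBoxAll.
Proof. exact (normal_comp _ _ normal_box normal_all). Qed.

Lemma normal_boxplus : normal MBoxPlus.
Proof.
  split; intros.
  - refine (taut_mp2 _ _ _ _ H (mm_box _ H)). taut.
  - refine (taut_mp1 _ _ _ (normal_K _ normal_box A B)). taut.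
Qed.

Lemma all_T A : |- MAll A ==> A.
Proof. apply (MK_instance A A _ MK_all_T). Qed.

Lemma all_4 A : |- MAll A ==> MAll (MAll A).
Proof. apply (MK_instance A A _ MK_all_4). Qed.

Lemma all_5 A : |- ~ MAll A ==> MAll (~ MAll A).
Proof. apply (MK_instance A A _ MK_all_5). Qed.

Lemma box_all_bridge A : |- MBox (MAll A) ==> MAll (MBox A).
Proof. apply (MK_instance A A _ MK_bridge). Qed.

(** The truth of [Box (All A)] spreads over a cluster: this is the bridge axiom
    for [All A], which S5 identifies with [All (All A)]. *)
Lemma box_all_box A : |- MBox (MAll A) ==> MAll (MBox (MAll A)).
Proof.
  refine (taut_mp2 _ _ _ _ (normal_mono _ _ _ normal_box (all_4 A))
            (box_all_bridge (MAll A))). taut.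
Qed.

Lemma ex_I A : |- A ==> MEx A.
Proof. refine (taut_mp1 _ _ _ (all_T (MNeg A))). taut. Qed.

Lemma all_ex_K A B : |- MAll (A ==> B) ==> MEx A ==> MEx B.
Proof.
  assert (H : |- MAll (A ==> B) ==> MAll (~ B) ==> MAll (~ A)).
  { apply normal_taut2; [exact normal_all | taut]. }
  refine (taut_mp1 _ _ _ H). taut.
Qed.

Lemma ex_mono A B : |- A ==> B -> |- MEx A ==> MEx B.
Proof.
  intros H. eapply mm_mp; [apply all_ex_K | now apply mm_all].
Qed.

Lemma ex_taut A B : tautology (A ==> B) -> |- MEx A ==> MEx B.
Proof.
  intros H. refine (taut_mp1 _ _ _ (normal_taut MAll (~ B) (~ A) normal_all _)); [taut |].
  intros v. specialize (H v). cbn in *. now destruct (beval v A), (beval v B).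
Qed.

Lemma ex_all_ex A : |- MEx A ==> MAll (MEx A).
Proof. apply all_5. Qed.

Lemma ex_all A : |- MEx (MAll A) ==> MAll A.
Proof. refine (taut_mp1 _ _ _ (all_5 A)). taut. Qed.

Lemma ex_ex A : |- MEx (MEx A) ==> MEx A.
Proof.
  refine (taut_mp3 _ _ _ _ _ (ex_mono _ _ (ex_all_ex A)) (ex_all (MEx A)) (all_T (MEx A))).
  taut.
Qed.

Lemma ex_or A B : |- MEx (A \/ B) ==> MEx A \/ MEx B.
Proof.
  assert (H : |- MAll (~ A) ==> MAll (~ B) ==> MAll (~ (A \/ B))).
  { apply normal_taut2; [exact normal_all | taut]. }
  refine (taut_mp1 _ _ _ H). taut.
Qed.

Lemma ex_and A B : |- MEx A /\ MEx B ==> MEx (MEx A /\ B).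
Proof.
  assert (H : |- MAll (MEx A) ==> MAll (~ (MEx A /\ B)) ==> MAll (~ B)).
  { apply normal_taut2; [exact normal_all | taut]. }
  refine (taut_mp2 _ _ _ _ H (ex_all_ex A)). taut.
Qed.

(** * The Goedel translation *)

Section Stable.

Context {HS4 : contains_S4 L}.

Lemma box_refl A : |- MBox A ==> A.
Proof. exact (mm_subst (fun _ => A) _ box_T_in). Qed.

Lemma box_trans A : |- MBox A ==> MBox (MBox A).
Proof. exact (mm_subst (fun _ => A) _ box_4_in). Qed.

(** The modal counterpart of persistence of intuitionistic truth. *)
Definition stable (A : mform) : Prop := |- A ==> MBox A.

Lemma stable_box A : stable (MBox A).
Proof. apply box_trans. Qed.

Lemma stable_and A B : stable A -> stable B -> stable (A /\ B)%mform.
Proof.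
  intros HA HB. refine (taut_mp3 _ _ _ _ _ HA HB (normal_and _ A B normal_box)). taut.
Qed.

Lemma stable_or A B : stable A -> stable B -> stable (A \/ B)%mform.
Proof.
  intros HA HB.
  assert (H1 : |- MBox A ==> MBox (A \/ B)).
  { apply normal_taut; [exact normal_box | taut]. }
  assert (H2 : |- MBox B ==> MBox (A \/ B)).
  { apply normal_taut; [exact normal_box | taut]. }
  refine (taut_mp2 _ _ _ _ (taut_mp2 _ _ (A ==> MBox (A \/ B))%mform _ HA H1)
                        (taut_mp2 _ _ (B ==> MBox (A \/ B))%mform _ HB H2)); taut.
Qed.

(** Dual form of the bridge axiom. From [Box A] one gets [Box All Ex A], hence
    [All Box Ex A]; the latter being universal, the premise may be weakened to
    [Ex Box A]. *)
Lemma ex_box A : |- MEx (MBox A) ==> MBox (MEx A).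
Proof.
  assert (H1 : |- MBox A ==> MBox (MAll (MEx A))).
  { apply normal_mono; [exact normal_box |].
    refine (taut_mp2 _ _ _ _ (ex_I A) (ex_all_ex A)). taut. }
  assert (H2 : |- MBox A ==> MAll (MBox (MEx A))).
  { refine (taut_mp2 _ _ _ _ H1 (box_all_bridge (MEx A))). taut. }
  refine (taut_mp3 _ _ _ _ _ (ex_mono _ _ H2) (ex_all (MBox (MEx A))) (all_T (MBox (MEx A)))).
  taut.
Qed.

Lemma stable_ex A : stable A -> stable (MEx A).
Proof.
  intros HA. refine (taut_mp2 _ _ _ _ (ex_mono _ _ HA) (ex_box A)). taut.
Qed.

(** Existential formulas are the delicate case, as their translation has no
    leading [Box]; it rests on [ex_box]. *)
Lemma stable_godel A : stable (godel A).
Proof.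
  induction A; cbn; auto using stable_box, stable_and, stable_or, stable_ex.
Qed.

Lemma box_intro G A : stable G -> |- G ==> A -> |- G ==> MBox A.
Proof.
  intros HG H. refine (taut_mp2 _ _ _ _ HG (normal_mono _ _ _ normal_box H)). taut.
Qed.

(** Deduction step: a stable context survives under the [Box] of a translated
    implication. *)
Lemma imp_intro G A B : stable G -> |- G /\ A ==> B -> |- G ==> MBox (A ==> B).
Proof. intros HG H. apply box_intro; [exact HG |]. refine (taut_mp1 _ _ _ H). taut. Qed.

Lemma boxall_T A : |- MBoxAll A ==> A.
Proof. refine (taut_mp2 _ _ _ _ (box_refl (MAll A)) (all_T A)). taut. Qed.

Lemma boxall_4 A : |- MBoxAll A ==> MBoxAll (MBoxAll A).
Proof.
  refine (taut_mp2 _ _ _ _ (box_trans (MAll A))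
            (normal_mono _ _ _ normal_box (box_all_box A))). taut.
Qed.

Lemma boxall_box_K A B : |- MBoxAll (MBox (A ==> B)) ==> MBoxAll A ==> MBoxAll B.
Proof.
  refine (taut_mp2 _ _ _ _ (normal_mono _ _ _ normal_boxall (box_refl (A ==> B)))
            (normal_K _ normal_boxall A B)). taut.
Qed.

Ltac stab :=
  repeat first [ assumption | apply stable_and | apply stable_box | apply stable_ex ].

(** Moves the antecedents of nested translated implications into a context. *)
Ltac to_context :=
  repeat first [ apply imp_intro; [stab |] | apply mm_box | apply thm_and ].

(** Forgets that the translated letters are translations, except that they are
    stable. *)
Ltac letters s :=
  cbn;
  generalize (stable_godel (s 0)), (stable_godel (s 1)), (stable_godel (s 2));
  generalize (godel (s 0)), (godel (s 1)), (godel (s 2));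
  intros p q r Hp Hq Hr.

Lemma godel_IPC_ax A s : IPC_ax A -> |- godel (isubst s A).
Proof.
  intros HA; destruct HA; letters s; to_context; try (apply thm_taut; taut).
  - refine (taut_mp3 _ _ _ _ _ (box_refl (p ==> MBox (q ==> r)))
              (box_refl (q ==> r)) (box_refl (p ==> q))). taut.
  - refine (taut_mp2 _ _ _ _ (box_refl (p ==> r)) (box_refl (q ==> r))). taut.
  - apply box_intro; [stab |].
    refine (taut_mp3 _ _ _ _ _ (box_refl (p ==> q))
              (box_refl (p ==> MBox (~ q))) (box_refl (~ q))). taut.
  - refine (taut_mp1 _ _ _ (box_refl (~ p))). taut.
Qed.

Lemma godel_MIPC_ax A s : MIPC_ax A -> |- godel (isubst s A).
Proof.
  intros HA; destruct HA; [now apply godel_IPC_ax | ..]; letters s;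
    fold (MBoxAll p); fold (MBoxAll q); to_context.
  - apply boxall_T.
  - apply boxall_4.
  - refine (taut_mp2 _ _ _ _ (normal_taut _ (p /\ q) p normal_boxall _)
              (normal_taut _ (p /\ q) q normal_boxall _)); taut.
  - refine (taut_mp1 _ _ _ (normal_and _ p q normal_boxall)). taut.
  - refine (taut_mp1 _ _ _ (boxall_box_K p q)). taut.
  - apply ex_I.
  - apply ex_ex.
  - apply ex_or.
  - refine (taut_mp2 _ _ _ _ (ex_taut p (p \/ q) _) (ex_taut q (p \/ q) _)); taut.
  - refine (taut_mp3 _ _ _ _ _ (ex_taut (MEx p /\ q) q _)
             (ex_taut (MEx p /\ q) (MEx p) _) (ex_ex p)); taut.
  - apply ex_and.
  - refine (taut_mp3 _ _ _ _ _ (box_refl (MAll (MBox (p ==> q))))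
       (normal_mono _ _ _ normal_all (box_refl (p ==> q))) (all_ex_K p q)). taut.
  - apply box_intro; [stab | apply ex_all_ex].
  - apply box_intro with (A := MAll p); [stab |].
    refine (taut_mp2 _ _ _ _ (ex_mono _ _ (box_refl (MAll p))) (ex_all p)). taut.
Qed.

(** [MBoxCas] has [Box p] where the translation of [MCas] has [p]; stability
    of [p] bridges the difference. *)
Lemma godel_MCas s :
  (|- MBoxCas) -> |- godel (isubst s MCas).
Proof.
  intros H.
  generalize (mm_subst (fun _ => godel (s 0)) _ H).
  unfold MCas, MBoxCas; letters s. clear r q Hr Hq.
  fold (MBoxAll p). intros H'. to_context.
  assert (H1 : |- MBox (MBox p ==> MBoxAll p) ==> MBox (p ==> MBoxAll p)).
  { apply normal_mono; [exact normal_box | refine (taut_mp1 _ _ _ Hp)]. taut. }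
  assert (H2 : |- MBox (MBox (p ==> MBoxAll p) ==> MBoxAll p) ==>
                  MBox (MBox p ==> MBoxAll p) ==> MBoxAll p).
  { refine (taut_mp2 _ _ _ _ H1 (box_refl (MBox (p ==> MBoxAll p) ==> MBoxAll p))). taut. }
  refine (taut_mp2 _ _ _ _ (normal_mono _ _ _ normal_boxall H2) H'). taut.
Qed.

End Stable.

End ModalCalculus.

Lemma is_mm_logic_mmlogic Ax : is_mm_logic (mmlogic Ax).
Proof.
  split.
  - intros A H. apply mclosure_ax. now left.
  - apply mclosure_subst.
  - apply mclosure_mp.
  - apply mclosure_box.
  - apply mclosure_all.
Qed.

Instance MpGrz_mm_logic : is_mm_logic MpGrz := is_mm_logic_mmlogic _.
Instance MGL_mm_logic : is_mm_logic MGL := is_mm_logic_mmlogic _.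

Instance MpGrz_S4 : contains_S4 MpGrz.
Proof.
  split; apply mclosure_ax; right; left; apply mclosure_ax; right; auto.
Qed.

Lemma isubst_isubst s t A : isubst s (isubst t A) = isubst (fun n => isubst s (t n)) A.
Proof. induction A; cbn; congruence. Qed.

Lemma isubst_id A : isubst IVar A = A.
Proof. induction A; cbn; congruence. Qed.

(** Substitution instances are built into the claim, because translation does
    not commute with substitution: a letter is translated to a boxed letter.
    The form of the lemma lets it be used at both levels of the definition of
    [MpIPC]. *)
Lemma godel_iclosure Ax L :
  is_mm_logic L -> contains_S4 L ->
  (forall A s, Ax A -> L (godel (isubst s A))) ->
  forall A, iclosure Ax A -> forall s, L (godel (isubst s A)).
Proof.
  intros HL HS4 HAx A HA.
  induction HA as [A HA | t A _ IH | A B _ IH1 _ IH2 | A _ IH]; intros s.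
  - now apply HAx.
  - rewrite isubst_isubst. apply IH.
  - eapply mm_mp, (IH2 s). eapply mm_mp; [apply box_refl | apply (IH1 s)].
  - apply mm_box, mm_all, IH.
Qed.

Theorem MpIPC_MpGrz A : MpIPC A -> MpGrz (godel A).
Proof.
  intros H. rewrite <- (isubst_id A). generalize IVar. revert A H.
  apply godel_iclosure; [exact _ | exact _ |]. intros A s [HA | ->].
  - revert A HA s. apply godel_iclosure; [exact _ | exact _ |].
    intros A s. apply godel_MIPC_ax.
  - apply godel_MCas, mclosure_ax. auto.
Qed.

(** * The splitting translation *)

Lemma MGL_gl A : MGL (MBox (MBox A ==> A) ==> MBox A).
Proof. apply (mclosure_subst _ (fun _ => A) gl), mclosure_ax. now right. Qed.

(** Loeb's axiom as a rule. *)
Lemma MGL_loeb A B : MGL (MBox A ==> B ==> A) ->  MGL (MBox B ==> MBox A).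
Proof.
  intros H. refine (taut_mp2 _ _ _ _ (normal_mono _ B (MBox A ==> A) normal_box _) (MGL_gl A)).
  - taut.
  - refine (taut_mp1 _ _ _ H). taut.
Qed.

(** Transitivity is not an axiom of [MGL]; it is obtained from Loeb's rule for
    [A /\ Box A]. *)
Lemma MGL_box_4 A : MGL (MBox A ==> MBox (MBox A)).
Proof.
  assert (H : MGL (MBox A ==> MBox (A /\ MBox A))).
  { apply MGL_loeb.
    refine (taut_mp1 _ _ _ (normal_taut _ (A /\ MBox A) A normal_box _)); taut. }
  refine (taut_mp2 _ _ _ _ H (normal_taut _ (A /\ MBox A) (MBox A) normal_box _)); taut.
Qed.

Lemma MGL_box_boxplus A : MGL (MBox A ==> MBox (MBoxPlus A)).
Proof.
  refine (taut_mp2 _ _ _ _ (MGL_box_4 A) (normal_and _ A (MBox A) normal_box)). taut.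
Qed.

(** The hypothesis [MBoxPlus B] implies its own box, so that it is available
    at every point at which Loeb's rule is applied. *)
Lemma MGL_loeb_boxplus A B :
  MGL (MBoxPlus B ==> MBox A ==> A) -> MGL (MBoxPlus B ==> MBoxPlus A).
Proof.
  intros H.
  assert (H1 : MGL (MBox (MBoxPlus B) ==> MBox A)).
  { apply MGL_loeb. refine (taut_mp1 _ _ _ H). taut. }
  refine (taut_mp3 _ _ _ _ _ H H1 (MGL_box_boxplus B)). taut.
Qed.

(** If [p] holds at all successors, then so does [p -> MBoxPlus p]; were [p]
    to fail here, this implication would hold here too, and the premise of
    [grz] would give [p]. *)
Lemma MGL_splitting_grz : MGL (splitting grz).
Proof.
  cbn. generalize (MVar 0); intros p.
  refine (taut_mp1 _ _ _ (MGL_loeb_boxplus p (MBoxPlus (p ==> MBoxPlus p) ==> p) _)); [taut |].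
  refine (taut_mp2 _ _ _ _ (MGL_box_boxplus p)
            (normal_taut _ (MBoxPlus p) (p ==> MBoxPlus p) normal_box _)); taut.
Qed.

(** Suppose [All A] fails. Then [A -> All A] holds exactly where [A] fails, so
    [A] cannot fail anywhere, as [All A] would follow there. *)
Lemma all_Cas {L} {HL : is_mm_logic L} A :
  L (MAll ((A ==> MAll A) ==> MAll A) ==> MAll A)%mform.
Proof.
  refine (taut_mp2 _ _ _ _ (all_5 A)
    (normal_taut2 _ ((A ==> MAll A) ==> MAll A) (~ MAll A) A normal_all _)); taut.
Qed.

(** By Loeb's rule assume [Box (All p)], for the whole cluster by [box_all_box].
    Strictly above, everything the formula speaks of is then true, so that
    [MBoxPlus] may be dropped throughout and [all_Cas] applies. *)
Lemma MGL_splitting_MBoxCas : MGL (splitting MBoxCas).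
Proof.
  cbn. fold (MBoxPlus (MAll (MVar 0))). generalize (MVar 0); intros p.
  set (D := (MBoxPlus (MBoxPlus p ==> MBoxPlus (MAll p)) ==> MBoxPlus (MAll p))%mform).
  apply (MGL_loeb_boxplus (MAll p) (MAll D)).
  assert (H : MGL (MBox (MAll p) ==> D ==> (p ==> MAll p) ==> MAll p)).
  { refine (taut_mp2 _ _ _ _ (MGL_box_boxplus (MAll p))
      (normal_taut _ (MBoxPlus (MAll p)) (MBoxPlus p ==> MBoxPlus (MAll p)) normal_box _));
      unfold D; taut. }
  refine (taut_mp3 _ _ _ _ _ (normal_mono2 _ _ _ _ normal_all H) (box_all_box p) (all_Cas p)).
  taut.
Qed.

Lemma splitting_msubst s A :
  splitting (msubst s A) = msubst (fun n => splitting (s n)) (splitting A).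
Proof. induction A; cbn; unfold MBoxPlus; congruence. Qed.

(** A tautology stays one when its atoms are replaced, here by the splitting
    translations of the modalized subformulas. *)
Lemma splitting_beval v A :
  beval v (splitting A) = beval (fun B => beval v (splitting B)) A.
Proof. induction A; cbn; congruence. Qed.

Lemma splitting_mclosure Ax L :
  is_mm_logic L -> (forall A, Ax A -> L (splitting A)) ->
  forall A, mclosure Ax A -> L (splitting A).
Proof.
  intros HL HAx A HA.
  induction HA as [A HA | t A _ IH | A B _ IH1 _ IH2 | A _ IH | A _ IH].
  - now apply HAx.
  - rewrite splitting_msubst. now apply mm_subst.
  - exact (mm_mp _ _ IH1 IH2).
  - apply (normal_nec _ normal_boxplus), IH.
  - now apply mm_all.
Qed.

Lemma splitting_MK_ax {L} {HL : is_mm_logic L} A : MK_ax A -> L (splitting A).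
Proof.
  intros HA; destruct HA as [A HA | | | | | |]; cbn.
  - apply thm_taut. intros v. rewrite splitting_beval. apply HA.
  - apply (normal_K _ normal_boxplus).
  - apply all_T.
  - apply all_4.
  - apply all_5.
  - apply (normal_K _ normal_all).
  - refine (taut_mp2 _ _ _ _ (box_all_bridge (MVar 0))
              (normal_and _ (MVar 0) (MBox (MVar 0)) normal_all)). taut.
Qed.

Theorem MpGrz_MGL A : MpGrz A -> MGL (splitting A).
Proof.
  revert A. apply splitting_mclosure; [exact _ |]. intros A [HA | [HA | ->]].
  - revert A HA. apply splitting_mclosure; [exact _ | apply splitting_MK_ax].
  - revert A HA. apply splitting_mclosure; [exact _ |]. intros A [HA | [-> | [-> | ->]]].
    + revert A HA. apply splitting_mclosure; [exact _ | apply splitting_MK_ax].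
    + cbn. apply thm_taut. taut.
    + cbn. refine (taut_mp1 _ _ _ (MGL_box_boxplus (MVar 0))). taut.
    + apply MGL_splitting_grz.
  - apply MGL_splitting_MBoxCas.
Qed.

(** * Frames for MGL *)

Section Frames.

Context {W : Type} (R E : W -> W -> Prop).

Fixpoint forces (V : nat -> W -> Prop) (A : mform) (w : W) : Prop :=
  match A with
  | MVar n => V n w
  | MAnd A B => forces V A w /\ forces V B w
  | MOr A B => forces V A w \/ forces V B w
  | MImp A B => forces V A w -> forces V B w
  | MNeg A => ~ forces V A w
  | MBox A => forall y, R w y -> forces V A y
  | MAll A => forall y, E w y -> forces V A y
  end.

Lemma forces_msubst V s A w :
  forces V (msubst s A) w <-> forces (fun n => forces V (s n)) A w.
Proof. revert w; induction A; cbn; intros w; firstorder. Qed.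

(** Forcing at a fixed point is a Boolean valuation of the modal atoms. *)
Lemma forces_tautology V A w : tautology A -> forces V A w.
Proof.
  intros HA.
  set (v B := if excluded_middle_informative (forces V B w) then true else false).
  assert (H : forall B, beval v B = true <-> forces V B w).
  { assert (Hv : forall B, v B = true <-> forces V B w).
    { intros B. unfold v. destruct (excluded_middle_informative (forces V B w)); easy. }
    induction B; cbn [beval forces]; try apply Hv.
    - rewrite Bool.andb_true_iff. tauto.
    - rewrite Bool.orb_true_iff. tauto.
    - rewrite Bool.implb_true_iff. tauto.
    - rewrite Bool.negb_true_iff, <- Bool.not_true_iff_false. tauto. }
  apply H, HA.
Qed.

(** Loeb's axiom corresponds to converse well-foundedness, the bridge axiom to
    [ER_RE]. *)
Record MGL_frame : Prop := {
  R_trans : forall x y z, R x y -> R y z -> R x z;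
  R_cwf : well_founded (fun y x => R x y);
  E_refl : forall x, E x x;
  E_sym : forall x y, E x y -> E y x;
  E_trans : forall x y z, E x y -> E y z -> E x z;
  ER_RE : forall x y z, E x y -> R y z -> exists w, R x w /\ E w z }.

(** Validity under all valuations is what is preserved by substitution. *)
Theorem MGL_sound :
  MGL_frame -> forall A, MGL A -> forall V w, forces V A w.
Proof.
  intros [HRt Hwf HEr HEs HEt HER].
  assert (Hclosure : forall Ax : mform -> Prop,
    (forall A, Ax A -> forall V w, forces V A w) ->
    forall A, mclosure Ax A -> forall V w, forces V A w).
  { intros Ax HAx A HA. induction HA as [| s A _ IH | A B _ IH1 _ IH2 | |]; intros V w.
    - now apply HAx.
    - apply forces_msubst, IH.
    - apply (IH1 V w), IH2.
    - cbn. auto.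
    - cbn. auto. }
  unfold MGL, mmlogic. apply Hclosure. intros A [HA | ->].
  - revert A HA. apply Hclosure. intros A HA V w. destruct HA; cbn.
    + now apply forces_tautology.
    + auto.
    + auto.
    + eauto.
    + intros H y Hy H'. apply H. eauto.
    + auto.
    + intros H y Hy z Hz. destruct (HER _ _ _ Hy Hz) as (u & Hu & Hz'). eauto.
  - intros V. cbn. intros w Hw y Hy. revert Hy.
    induction (Hwf y) as [y _ IH]. intros Hy. apply Hw; [exact Hy |].
    intros z Hz. eauto.
Qed.

End Frames.

(** * Prime theories of M+IPC *)

Lemma MIPC_instance A B C D :
  MIPC_ax D ->
  MpIPC (isubst (fun n => match n with 0 => A | 1 => B | _ => C end) D).
Proof.
  intros H. apply iclosure_subst, iclosure_ax. left. now apply iclosure_ax.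
Qed.

Lemma IPC_instance A B C D :
  IPC_ax D ->
  MpIPC (isubst (fun n => match n with 0 => A | 1 => B | _ => C end) D).
Proof. intros H. apply MIPC_instance. now constructor. Qed.

Lemma thm_andl A B : MpIPC (A /\ B) -> MpIPC A.
Proof. apply iclosure_mp, (IPC_instance A B A _ IPC_andl). Qed.

Lemma thm_andr A B : MpIPC (A /\ B) -> MpIPC B.
Proof. apply iclosure_mp, (IPC_instance A B A _ IPC_andr). Qed.

Lemma MCas_instance A : MpIPC (IAll ((A ==> IAll A) ==> IAll A) ==> IAll A).
Proof.
  apply (iclosure_subst _ (fun _ => A) MCas), iclosure_ax. now right.
Qed.

(** Derivability from hypotheses uses theorems and modus ponens only; with
    necessitation of hypotheses the deduction theorem [der_imp] would fail. *)
Inductive der (G : iform -> Prop) : iform -> Prop :=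
| der_hyp A : G A -> der G A
| der_thm A : MpIPC A -> der G A
| der_mp A B : der G (A ==> B) -> der G A -> der G B.

Definition add (G : iform -> Prop) (A B : iform) : Prop := G B \/ B = A.

Lemma der_mono G H A : (forall B, G B -> H B) -> der G A -> der H A.
Proof. intros HGH HA. induction HA; eauto using der. Qed.

Lemma der_imp G A B : der (add G A) B -> der G (A ==> B).
Proof.
  intros HB. induction HB as [B [HB | ->] | B HB | B C _ IH1 _ IH2].
  - eapply der_mp; [apply der_thm, (IPC_instance B A A _ IPC_K) | now apply der_hyp].
  - eapply der_mp; [eapply der_mp; apply der_thm |].
    + apply (IPC_instance A (A ==> A)%iform A _ IPC_S).
    + apply (IPC_instance A (A ==> A)%iform A _ IPC_K).
    + apply der_thm, (IPC_instance A A A _ IPC_K).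
  - apply der_thm. eapply iclosure_mp; [apply (IPC_instance B A A _ IPC_K) | exact HB].
  - eapply der_mp; [eapply der_mp; [apply der_thm, (IPC_instance A B C _ IPC_S) |] |];
      eassumption.
Qed.

Lemma MpIPC_empty A : der (fun _ => False) A -> MpIPC A.
Proof. intros H. induction H; [easy | easy | eapply iclosure_mp; eassumption]. Qed.

(** An injection into the natural numbers, which orders the formulas for the
    construction of maximal theories. *)
Fixpoint code (A : iform) : nat :=
  match A with
  | IVar n => to_nat (0, n)
  | IAnd A B => to_nat (1, to_nat (code A, code B))
  | IOr A B => to_nat (2, to_nat (code A, code B))
  | IImp A B => to_nat (3, to_nat (code A, code B))
  | INeg A => to_nat (4, code A)
  | IAll A => to_nat (5, code A)
  | IEx A => to_nat (6, code A)
  end.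

Lemma code_inj A B : code A = code B -> A = B.
Proof.
  assert (Hinj : forall p q, to_nat p = to_nat q -> p = q).
  { intros p q H. now rewrite <- (cancel_of_to p), H, cancel_of_to. }
  revert B; induction A; intros []; cbn [code]; intros H;
    apply Hinj, pair_equal_spec in H as [Hc H]; try discriminate Hc;
    try apply Hinj, pair_equal_spec in H as [H1 H2]; f_equal; auto.
Qed.

Record prime (x : iform -> Prop) : Prop := {
  prime_closed : forall A, der x A -> x A;
  prime_or : forall A B, x (A \/ B)%iform -> x A \/ x B;
  prime_proper : exists A, ~ x A }.

(** The directed set [D] acts as one disjunction to be avoided. A theory that is
    maximal among those avoiding [D] is prime, since refutations of two
    disjuncts lead to a common element of [D]. The existence of cluster mates
    ([prime_ex_witness]) needs an infinite [D]. *)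
Section Lindenbaum.

Context (G D : iform -> Prop).

Definition avoids (H : iform -> Prop) : Prop := forall A, D A -> ~ der H A.

Fixpoint stage (n : nat) : iform -> Prop :=
  match n with
  | 0 => G
  | S n => fun A => stage n A \/ (code A = n /\ avoids (add (stage n) A))
  end.

Definition limit (A : iform) : Prop := exists n, stage n A.

Lemma stage_le n m A : n <= m -> stage n A -> stage m A.
Proof. induction 1; cbn; auto. Qed.

Lemma stage_avoids : avoids G -> forall n, avoids (stage n).
Proof.
  intros HG n. induction n as [| n IH]; [exact HG |]. intros B HB HdB.
  destruct (classic (exists A, code A = n /\ avoids (add (stage n) A)))
    as [(A & HA & Hav) | Hno].
  - apply (Hav B HB). eapply der_mono, HdB. intros C [HC | [HC _]]; [now left |].
    right. apply code_inj. congruence.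
  - apply (IH B HB). eapply der_mono, HdB. intros C [HC | HC]; [exact HC |].
    exfalso; eauto.
Qed.

Lemma limit_compact A : der limit A -> exists n, der (stage n) A.
Proof.
  intros H. induction H as [A [n Hn] | A HA | A B _ [n Hn] _ [m Hm]].
  - exists n. now apply der_hyp.
  - exists 0. now apply der_thm.
  - exists (max n m).
    eapply der_mp; eapply der_mono; try eassumption; intros C; apply stage_le; lia.
Qed.

Lemma limit_maximal A : ~ limit A -> exists B, D B /\ der (add limit A) B.
Proof.
  intros HA. apply NNPP. intros Hno. apply HA. exists (S (code A)). right.
  split; [reflexivity |]. intros B HB HdB. apply Hno. exists B. split; [exact HB |].
  eapply der_mono, HdB. intros C [HC | HC]; [left; now exists (code A) | now right].
Qed.

Lemma prime_extension :
  (exists A, D A) ->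
  (forall A B, D A -> D B -> exists C, D C /\ MpIPC (A ==> C) /\ MpIPC (B ==> C)) ->
  avoids G ->
  exists x, prime x /\ (forall A, G A -> x A) /\ (forall A, D A -> ~ x A).
Proof.
  intros [A0 HA0] Hdir HG.
  assert (Hav : avoids limit).
  { intros A HA Hd. destruct (limit_compact A Hd) as [n Hn].
    exact (stage_avoids HG n A HA Hn). }
  exists limit. split; [split | split].
  - intros A Hd. apply NNPP. intros HA. destruct (limit_maximal A HA) as (B & HB & HdB).
    apply (Hav B HB). eapply der_mp; [apply der_imp |]; eassumption.
  - intros A B HAB. apply NNPP. intros Hno.
    destruct (limit_maximal A) as (A' & HA' & HdA'); [tauto |].
    destruct (limit_maximal B) as (B' & HB' & HdB'); [tauto |].
    destruct (Hdir A' B' HA' HB') as (C & HC & HAC & HBC).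
    apply (Hav C HC).
    eapply der_mp; [eapply der_mp; [eapply der_mp |] |].
    + apply der_thm, (IPC_instance A B C _ IPC_or).
    + apply der_imp. eapply der_mp; [apply der_thm, HAC | exact HdA'].
    + apply der_imp. eapply der_mp; [apply der_thm, HBC | exact HdB'].
    + now apply der_hyp.
  - exists A0. intros HA. apply (Hav A0 HA0). now apply der_hyp.
  - intros A HA. now exists 0.
  - intros A HA HlA. apply (Hav A HA). now apply der_hyp.
Qed.

End Lindenbaum.

Lemma prime_extension1 G A :
  ~ der G A -> exists x, prime x /\ (forall B, G B -> x B) /\ ~ x A.
Proof.
  intros HA.
  destruct (prime_extension G (fun B => B = A)) as (x & Hx & HG & HD).
  - now exists A.
  - intros B C -> ->. exists A. split; [reflexivity |].
    assert (H : MpIPC (A ==> A)) by (apply MpIPC_empty, der_imp, der_hyp; now right).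
    split; exact H.
  - intros B ->. exact HA.
  - exists x. auto.
Qed.

Section PrimeTheories.

Context {x : iform -> Prop} (Hx : prime x).

Lemma prime_thm A : MpIPC A -> x A.
Proof. intros H. now apply (prime_closed x Hx), der_thm. Qed.

Lemma prime_mp A B : x (A ==> B)%iform -> x A -> x B.
Proof.
  intros HAB HA. apply (prime_closed x Hx). eapply der_mp; apply der_hyp; eassumption.
Qed.

Lemma prime_mp_thm A B : MpIPC (A ==> B) -> x A -> x B.
Proof. intros H. apply prime_mp, prime_thm, H. Qed.

Lemma prime_const A B : x B -> x (A ==> B)%iform.
Proof. apply prime_mp_thm, (IPC_instance B A A _ IPC_K). Qed.

Lemma prime_and A B : x (A /\ B)%iform <-> x A /\ x B.
Proof.
  split.
  - intros H. split; revert H; apply prime_mp_thm.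
    + apply (IPC_instance A B A _ IPC_andl).
    + apply (IPC_instance A B A _ IPC_andr).
  - intros [HA HB]. eapply prime_mp, HB. revert HA. apply prime_mp_thm.
    apply (IPC_instance A B A _ IPC_and).
Qed.

Lemma prime_or_iff A B : x (A \/ B)%iform <-> x A \/ x B.
Proof.
  split; [apply (prime_or x Hx) |].
  intros [H | H]; revert H; apply prime_mp_thm.
  - apply (IPC_instance A B A _ IPC_orl).
  - apply (IPC_instance A B A _ IPC_orr).
Qed.

Lemma prime_neg A : x (~ A)%iform -> ~ x A.
Proof.
  intros Hn HA. destruct (prime_proper x Hx) as [B HB]. apply HB.
  eapply prime_mp, HA. revert Hn. apply prime_mp_thm, (IPC_instance A B A _ IPC_efq).
Qed.

Lemma prime_imp_witness A B :
  ~ x (A ==> B)%iform ->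
  exists y, prime y /\ (forall C, x C -> y C) /\ y A /\ ~ y B.
Proof.
  intros H.
  destruct (prime_extension1 (add x A) B) as (y & Hy & Hxy & HB).
  - intros Hd. apply H, (prime_closed x Hx), der_imp, Hd.
  - exists y. split; [exact Hy | split; [| split]].
    + intros C HC. apply Hxy. now left.
    + apply Hxy. now right.
    + exact HB.
Qed.

Lemma prime_neg_witness A :
  ~ x (~ A)%iform -> exists y, prime y /\ (forall C, x C -> y C) /\ y A.
Proof.
  intros H.
  destruct (prime_extension1 (add x A) (~ A)) as (y & Hy & Hxy & _).
  - intros Hd. apply H, (prime_closed x Hx).
    eapply der_mp; [eapply der_mp; [apply der_thm, (IPC_instance A A A _ IPC_neg) |] |].
    + apply der_imp, der_hyp. now right.
    + apply der_imp, Hd.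
  - exists y. split; [exact Hy | split].
    + intros C HC. apply Hxy. now left.
    + apply Hxy. now right.
Qed.

Lemma prime_all_der A : der (fun C => x (IAll C)) A -> x (IAll A).
Proof.
  intros H. induction H as [| A HA | A B _ IH1 _ IH2].
  - assumption.
  - now apply prime_thm, iclosure_nec.
  - eapply prime_mp, IH2. revert IH1.
    apply prime_mp_thm, (MIPC_instance A B A _ MIPC_all_K).
Qed.

Lemma prime_all_T A : x (IAll A) -> x A.
Proof. apply prime_mp_thm, (MIPC_instance A A A _ MIPC_all_T). Qed.

Lemma prime_all_4 A : x (IAll A) -> x (IAll (IAll A)).
Proof. apply prime_mp_thm, (MIPC_instance A A A _ MIPC_all_4). Qed.

Lemma prime_ex_T A : x A -> x (IEx A).
Proof. apply prime_mp_thm, (MIPC_instance A A A _ MIPC_ex_T). Qed.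

(** The theory found lies above a member of the cluster of [x]; only the modal
    formulas of [x] are passed on to it. *)
Lemma prime_all_witness A :
  ~ x (IAll A) ->
  exists y, prime y /\ (forall C, x (IAll C) -> y (IAll C)) /\
            (forall C, x (IEx C) -> y (IEx C)) /\ ~ y A.
Proof.
  intros H.
  destruct (prime_extension1 (fun C => x (IAll C)) A) as (y & Hy & Hxy & HA).
  - intros Hd. apply H, prime_all_der, Hd.
  - exists y. split; [exact Hy | split; [| split; [| exact HA]]].
    + intros C HC. apply Hxy, prime_all_4, HC.
    + intros C HC. apply Hxy. revert HC.
      apply prime_mp_thm, (MIPC_instance C C C _ MIPC_ex_all_ex).
Qed.

End PrimeTheories.

Definition Ibot : iform := (IVar 0 /\ ~ IVar 0)%iform.

Lemma prime_bot x : prime x -> ~ x Ibot.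
Proof.
  intros Hx H. apply (prime_and Hx) in H. now apply (prime_neg Hx (IVar 0)).
Qed.

(** [Ibot -> All Ibot] is provable, so [Ex Ibot] implies [Ex (All Ibot)], hence
    [All Ibot]. *)
Lemma prime_ex_bot x : prime x -> ~ x (IEx Ibot).
Proof.
  intros Hx H. apply (prime_bot x Hx), (prime_all_T Hx).
  assert (Hk : MpIPC (Ibot ==> IAll Ibot)).
  { apply MpIPC_empty, der_imp.
    assert (Hb : der (add (fun _ => False) Ibot) Ibot) by (apply der_hyp; now right).
    eapply der_mp; [eapply der_mp |].
    - apply der_thm, (IPC_instance (IVar 0) (IAll Ibot) Ibot _ IPC_efq).
    - eapply der_mp, Hb.
      apply der_thm, (IPC_instance (IVar 0) (~ IVar 0)%iform Ibot _ IPC_andr).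
    - eapply der_mp, Hb.
      apply der_thm, (IPC_instance (IVar 0) (~ IVar 0)%iform Ibot _ IPC_andl). }
  apply (prime_mp_thm Hx (IEx (IAll Ibot)) (IAll Ibot)).
  - apply (MIPC_instance Ibot Ibot Ibot _ MIPC_ex_all).
  - revert H. apply (prime_mp Hx), (prime_mp_thm Hx (IAll (Ibot ==> IAll Ibot))).
    + apply (MIPC_instance Ibot (IAll Ibot) Ibot _ MIPC_all_ex_K).
    + now apply (prime_thm Hx), iclosure_nec.
Qed.

(** A theory with exactly the modal formulas of [x] that contains [A]. It has to
    avoid the existential formulas missing from [x], which form a directed set
    because [Ex] distributes over disjunction; universal formulas then agree
    too, as [All C] is equivalent to [Ex (All C)]. *)
Lemma prime_ex_witness x A :
  prime x -> x (IEx A) ->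
  exists y, prime y /\ (forall C, x (IAll C) <-> y (IAll C)) /\
            (forall C, x (IEx C) <-> y (IEx C)) /\ y A.
Proof.
  intros Hx HA.
  destruct (prime_extension (add (fun C => x (IAll C)) A)
              (fun B => exists C, B = IEx C /\ ~ x (IEx C))) as (y & Hy & Hxy & HD).
  - exists (IEx Ibot), Ibot. split; [reflexivity | apply prime_ex_bot, Hx].
  - intros ? ? (B & -> & HB) (C & -> & HC). exists (IEx (B \/ C)).
    assert (Hor : x (IEx (B \/ C)) -> x (IEx B) \/ x (IEx C)).
    { intros H. apply (prime_or x Hx). revert H. apply (prime_mp Hx).
      apply (prime_thm Hx), (thm_andl _ _ (MIPC_instance B C C _ MIPC_ex_or)). }
    split; [exists (B \/ C)%iform; split; tauto |].
    assert (Hor' : MpIPC (IEx B \/ IEx C ==> IEx (B \/ C))).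
    { apply (thm_andr _ _ (MIPC_instance B C C _ MIPC_ex_or)). }
    split; apply MpIPC_empty, der_imp; (eapply der_mp; [apply der_thm, Hor' |]);
      (eapply der_mp; [apply der_thm | apply der_hyp; right; reflexivity]).
    + apply (IPC_instance (IEx B) (IEx C) B _ IPC_orl).
    + apply (IPC_instance (IEx B) (IEx C) B _ IPC_orr).
  - intros ? (B & -> & HB) Hd. apply HB.
    apply (prime_mp_thm Hx (IEx (IEx B))).
    { apply (MIPC_instance B B B _ MIPC_ex_4). }
    revert HA. apply (prime_mp Hx), (prime_mp_thm Hx (IAll (A ==> IEx B))).
    { apply (MIPC_instance A (IEx B) B _ MIPC_all_ex_K). }
    apply (prime_all_der Hx), der_imp, Hd.
  - assert (Hall : forall C, x (IAll C) -> y (IAll C)).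
    { intros C HC. apply Hxy. left. apply (prime_all_4 Hx), HC. }
    assert (Hex : forall C, y (IEx C) -> x (IEx C)).
    { intros C HC. apply NNPP. intros HnC. eapply HD, HC. eauto. }
    exists y. split; [exact Hy | split; [| split]].
    + split; [apply Hall |]. intros HC.
      apply (prime_mp_thm Hx (IEx (IAll C))), Hex, (prime_ex_T Hy), HC.
      apply (MIPC_instance C C C _ MIPC_ex_all).
    + split; [| apply Hex]. intros HC. apply Hxy. left. revert HC.
      apply (prime_mp_thm Hx), (MIPC_instance C C C _ MIPC_ex_all_ex).
    + apply Hxy. now right.
Qed.

(** By [MCas] the formula [(A -> All A) -> All A] fails somewhere above [x]. *)
Lemma prime_Cas_witness x A :
  prime x -> ~ x (IAll A) ->
  exists y, prime y /\ (forall C, x (IAll C) -> y (IAll C)) /\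
            (forall C, x (IEx C) -> y (IEx C)) /\
            y (A ==> IAll A)%iform /\ ~ y (IAll A).
Proof.
  intros Hx H.
  destruct (prime_all_witness Hx ((A ==> IAll A) ==> IAll A)) as (y & Hy & Hall & Hex & HA).
  { intros H'. apply H. revert H'. apply (prime_mp_thm Hx), MCas_instance. }
  destruct (prime_imp_witness Hy _ _ HA) as (z & Hz & Hyz & Hz1 & Hz2).
  exists z. auto 6.
Qed.

(** * The model of saturated theories *)

Definition Itop : iform := (IVar 0 ==> IVar 0)%iform.

Definition bigand (T : list iform) : iform := fold_right IAnd Itop T.

Lemma thm_top : MpIPC Itop.
Proof. apply MpIPC_empty, der_imp, der_hyp. now right. Qed.

Lemma prime_bigand x T : prime x -> (x (bigand T) <-> forall A, In A T -> x A).
Proof.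
  intros Hx. induction T as [| A T IH]; cbn [bigand fold_right In].
  - split; [easy |]. intros _. apply (prime_thm Hx), thm_top.
  - rewrite (prime_and Hx). fold (bigand T). rewrite IH. split.
    + intros [HA HT] B [<- | HB]; auto.
    + intros H. split; auto.
Qed.

Fixpoint sublists (l : list iform) : list (list iform) :=
  match l with
  | [] => [[]]
  | A :: l => sublists l ++ map (cons A) (sublists l)
  end.

Lemma sublists_nil l : In [] (sublists l).
Proof. induction l; cbn; auto using in_or_app. Qed.

Lemma sublists_select (P : iform -> Prop) l :
  exists T, In T (sublists l) /\ forall A, In A T <-> In A l /\ P A.
Proof.
  induction l as [| B l (T & HT & IH)]; cbn.
  - exists []. cbn. intuition.
  - destruct (classic (P B)) as [HB | HB].
    + exists (B :: T). split; [apply in_or_app; right; now apply in_map |].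
      intros A. cbn. rewrite IH. intuition congruence.
    + exists T. split; [apply in_or_app; now left |].
      intros A. rewrite IH. intuition congruence.
Qed.

(** Strict growth, as far as formulas of [l] are concerned. *)
Definition gains (l : list iform) (x y : iform -> Prop) : Prop :=
  (forall A, In A l -> x A -> y A) /\ (exists A, In A l /\ y A /\ ~ x A).

(** Each gain removes a formula from a list that contains the formulas of [l]
    not yet in the theory. *)
Lemma gains_wf l : well_founded (fun y x => gains l x y).
Proof.
  assert (H : forall n m x, length m <= n ->
            (forall A, In A l -> ~ x A -> In A m) -> Acc (fun y x => gains l x y) x).
  { induction n as [| n IH]; intros m x Hm Hx; constructor; intros y [Hxy (A & HA & Hy & HnA)].
    - destruct m; [destruct (Hx A HA HnA) | cbn in Hm; lia].
    - destruct (in_split _ _ (Hx A HA HnA)) as (m1 & m2 & ->).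
      apply (IH (m1 ++ m2)); [rewrite length_app in *; cbn in Hm; lia |].
      intros B HB HnB. assert (HBm := Hx B HB (fun h => HnB (Hxy B HB h))).
      apply in_app_or in HBm. apply in_or_app.
      destruct HBm as [HBm | [<- | HBm]]; tauto. }
  intros x. now apply (H (length l) l).
Qed.

Section Model.

Context (Sigma : list iform) (Sigma_bot : In Ibot Sigma).

(** The formulas that describe a cluster: the modal members of [Sigma], the
    formulas telling which [T] are contained in a type of the cluster, and those
    telling by their absence that some theory above contains [T] and omits [B]. *)
Definition info : list iform :=
  map IAll Sigma ++ map IEx Sigma ++ map (fun T => IEx (bigand T)) (sublists Sigma) ++
  flat_map (fun T => map (fun B => IAll (bigand T ==> B)) Sigma) (sublists Sigma).

Lemma info_all A : In A Sigma -> In (IAll A) info.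
Proof. intros H. apply in_or_app. left. now apply in_map. Qed.

Lemma info_ex A : In A Sigma -> In (IEx A) info.
Proof. intros H. apply in_or_app. right. apply in_or_app. left. now apply in_map. Qed.

Lemma info_type T : In T (sublists Sigma) -> In (IEx (bigand T)) info.
Proof.
  intros H. do 2 (apply in_or_app; right). apply in_or_app. left.
  now apply (in_map (fun T => IEx (bigand T))).
Qed.

Lemma info_request T B :
  In T (sublists Sigma) -> In B Sigma -> In (IAll (bigand T ==> B)) info.
Proof.
  intros HT HB. do 3 (apply in_or_app; right). apply in_flat_map. exists T.
  split; [exact HT |]. now apply (in_map (fun B => IAll (bigand T ==> B))).
Qed.

Lemma info_modal A : In A info -> exists B, A = IAll B \/ A = IEx B.
Proof.
  unfold info. rewrite !in_app_iff, !in_map_iff, in_flat_map.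
  intros [(B & <- & _) | [(B & <- & _) | [(B & <- & _) | (T & _ & HA)]]]; eauto.
  apply in_map_iff in HA. destruct HA as (B & <- & _). eauto.
Qed.

Definition info_le (x y : iform -> Prop) : Prop := forall A, In A info -> x A -> y A.
Definition type_le (x y : iform -> Prop) : Prop := forall A, In A Sigma -> x A -> y A.

Lemma info_le_modal x y :
  (forall A, x (IAll A) -> y (IAll A)) -> (forall A, x (IEx A) -> y (IEx A)) ->
  info_le x y.
Proof.
  intros Hall Hex A HA. destruct (info_modal A HA) as [B [-> | ->]]; auto.
Qed.

(** With the information kept, the type cannot grow any further. *)
Definition saturated (x : iform -> Prop) : Prop :=
  forall y, prime y -> (forall A, x A -> y A) -> info_le y x -> type_le y x.

Definition world : Type := {x : iform -> Prop | prime x /\ saturated x}.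

Definition mem (w : world) : iform -> Prop := proj1_sig w.

Lemma mem_prime w : prime (mem w).
Proof. exact (proj1 (proj2_sig w)). Qed.

Lemma mem_saturated w : saturated (mem w).
Proof. exact (proj2 (proj2_sig w)). Qed.

Lemma saturation x :
  prime x ->
  exists w, (forall A, x A -> mem w A) /\ info_le (mem w) x.
Proof.
  induction (gains_wf Sigma x) as [x _ IH]. intros Hx.
  destruct (classic (saturated x)) as [Hs | Hs].
  - exists (exist _ x (conj Hx Hs)). split; [easy | now intros A].
  - apply not_all_ex_not in Hs. destruct Hs as [y Hy].
    apply imply_to_and in Hy. destruct Hy as [Hpy Hy].
    apply imply_to_and in Hy. destruct Hy as [Hxy Hy].
    apply imply_to_and in Hy. destruct Hy as [Hi Hy].
    apply not_all_ex_not in Hy. destruct Hy as [A HA].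
    apply imply_to_and in HA. destruct HA as [HAS HA].
    apply imply_to_and in HA.
    destruct (IH y) as (w & Hyw & Hwi).
    + split; [auto |]. now exists A.
    + exact Hpy.
    + exists w. split; [auto |]. intros B HB HwB. auto.
Qed.

(** The information contains [All q] for the request [q := bigand T ==> B]. By
    [MCas] there is [v] above with [q -> All q] in it and [All q] not in it, so
    [v] extends to a theory [z] fulfilling the request. Saturating [z] keeps
    [All q] out, hence [q] as well, hence [B]. *)
Lemma saturated_refutation x T B :
  prime x -> In T (sublists Sigma) -> In B Sigma -> ~ x (IAll (bigand T ==> B)) ->
  exists w, info_le x (mem w) /\ (forall A, In A T -> mem w A) /\ ~ mem w B.
Proof.
  intros Hx HT HB Hn.
  destruct (prime_Cas_witness x _ Hx Hn) as (v & Hv & Hall & Hex & HCas & Hvn).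
  destruct (prime_imp_witness Hv (bigand T) B) as (z & Hz & Hvz & HzT & HzB).
  { intros Hp. apply Hvn. now apply (prime_mp Hv (bigand T ==> B)). }
  destruct (saturation z Hz) as (w & Hzw & Hwz). exists w. split; [| split].
  - intros A HA HxA. apply Hzw, Hvz. revert A HA HxA. now apply info_le_modal.
  - apply (prime_bigand _ T (mem_prime w)), Hzw, HzT.
  - intros HwB. apply HzB, (prime_mp Hz (bigand T)), HzT.
    apply (prime_all_T Hz), Hwz; [now apply info_request |].
    apply (prime_mp (mem_prime w) (bigand T ==> B)); [now apply Hzw, Hvz |].
    now apply (prime_const (mem_prime w)).
Qed.

Lemma saturated_ex_witness x A :
  prime x -> x (IEx A) ->
  exists w, info_le x (mem w) /\ info_le (mem w) x /\ mem w A.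
Proof.
  intros Hx HA. destruct (prime_ex_witness x A Hx HA) as (y & Hy & Hall & Hex & HyA).
  destruct (saturation y Hy) as (w & Hyw & Hwy). exists w. split; [| split; [| auto]].
  - intros B HB HxB. apply Hyw. revert B HB HxB. apply info_le_modal; firstorder.
  - intros B HB HwB. apply (info_le_modal y x); [firstorder | firstorder | exact HB | auto].
Qed.

(** The type of [x] is recorded in the information by a formula
    [Ex (bigand T)], which a cluster with more information realizes. *)
Lemma cluster_lift x w :
  prime x -> info_le x (mem w) ->
  exists u, info_le (mem w) (mem u) /\ info_le (mem u) (mem w) /\ type_le x (mem u).
Proof.
  intros Hx Hxw.
  destruct (sublists_select x Sigma) as (T & HT & HTx).
  destruct (saturated_ex_witness (mem w) (bigand T) (mem_prime w)) as (u & Hwu & Huw & HuT).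
  { apply Hxw; [now apply info_type |]. apply (prime_ex_T Hx), (prime_bigand x T Hx).
    intros A HA. now apply HTx. }
  exists u. split; [exact Hwu | split; [exact Huw |]].
  intros A HA HxA. apply (prime_bigand _ T (mem_prime u)); [exact HuT | now apply HTx].
Qed.

(** Strictness is required of the information; theories of one cluster are
    never related, whatever their types. *)
Definition R (w u : world) : Prop := gains info (mem w) (mem u) /\ type_le (mem w) (mem u).
Definition E (w u : world) : Prop := info_le (mem w) (mem u) /\ info_le (mem u) (mem w).

Lemma gains_R w u : info_le (mem w) (mem u) -> ~ E w u -> gains info (mem w) (mem u).
Proof.
  intros Hle Hn. split; [exact Hle |]. apply NNPP. intros Hno. apply Hn.
  split; [exact Hle |]. intros A HA HuA. apply NNPP. intros HwA. eauto.
Qed.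

Lemma model_frame : MGL_frame R E.
Proof.
  split.
  - intros x y z [[H1 (A & HA & HyA & HxA)] H2] [[H3 _] H4].
    split; [split; [auto |] | intros B HB HxB; auto]. exists A. auto.
  - intros w. assert (Hwf := gains_wf info (mem w)). remember (mem w) as x eqn:Hx.
    revert w Hx. induction Hwf as [x _ IH]. intros w ->. constructor. intros u [Hu _].
    now apply (IH (mem u)).
  - intros x. now split; intros A.
  - intros x y [H1 H2]. now split.
  - intros x y z [H1 H2] [H3 H4]. split; intros A HA HxA; auto.
  - intros x y z [H1 H2] [[H3 (A & HA & HzA & HyA)] _].
    destruct (cluster_lift (mem x) z (mem_prime x)) as (u & Hzu & Huz & Hxu).
    { intros B HB HxB. auto. }
    exists u. split; [split; [split |] | split]; [ | | assumption ..].
    + intros B HB HxB. auto.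
    + exists A. split; [exact HA | split; [now apply Hzu | auto]].
Qed.

(** The type of [w] is part of the request, so that the type grows. If the
    witness had only the information of [w], then so would [u], which extends
    [w] and has [A] new in its type, against the saturation of [w]. *)
Lemma imp_refutation w u A B :
  In A Sigma -> In B Sigma -> ~ mem w A ->
  prime u -> (forall C, mem w C -> u C) -> u A -> ~ u B ->
  exists z, R w z /\ mem z A /\ ~ mem z B.
Proof.
  intros HA HB HwA Hu Hwu HuA HuB.
  destruct (sublists_select (fun C => mem w C \/ C = A) Sigma) as (T & HT & HTw).
  destruct (saturated_refutation u T B Hu HT HB) as (z & Huz & HzT & HzB).
  { intros H. apply HuB, (prime_mp Hu (bigand T)); [now apply (prime_all_T Hu) |].
    apply (prime_bigand u T Hu). intros C HC. apply HTw in HC.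
    destruct HC as [_ [HC | ->]]; auto. }
  exists z. split; [| split].
  - split; [split |].
    + intros C HC HwC. auto.
    + apply NNPP. intros Hno. apply HwA, (mem_saturated w u Hu Hwu); auto.
      intros C HC HuC. apply NNPP. intros HwC. apply Hno.
      exists C. split; [exact HC | split; [now apply Huz | exact HwC]].
    + intros C HC HwC. apply HzT, HTw. auto.
  - apply HzT, HTw. auto.
  - exact HzB.
Qed.

(** The request with empty [T]. *)
Lemma all_refutation w A :
  In A Sigma -> ~ mem w (IAll A) -> exists z, info_le (mem w) (mem z) /\ ~ mem z A.
Proof.
  intros HA Hn. assert (Hw := mem_prime w).
  destruct (saturated_refutation (mem w) [] A Hw (sublists_nil Sigma) HA)
    as (z & Hwz & _ & Hz).
  - intros H. apply Hn.
    apply (prime_mp Hw (IAll Itop)); [| now apply (prime_thm Hw), iclosure_nec, thm_top].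
    revert H. apply (prime_mp_thm Hw), (MIPC_instance Itop A A _ MIPC_all_K).
  - eauto.
Qed.

Lemma all_E w u A : In A Sigma -> info_le (mem w) (mem u) -> mem w (IAll A) -> mem u A.
Proof.
  intros HA H HwA. apply (prime_all_T (mem_prime u)), H; [now apply info_all | exact HwA].
Qed.

Fixpoint subformulas (A : iform) : list iform :=
  A :: match A with
       | IVar _ => []
       | IAnd B C | IOr B C | IImp B C => subformulas B ++ subformulas C
       | INeg B | IAll B | IEx B => subformulas B
       end.

Lemma subformulas_refl A : In A (subformulas A).
Proof. destruct A; now left. Qed.

Definition valuation (n : nat) (w : world) : Prop := mem w (IVar n).

(** Refutations of implications by [w] itself are covered by the reflexive part
    of the translation, all others by [imp_refutation]. For a universal formula
    the theory that refutes it may have the information of [w] and then lies in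
    its cluster; otherwise [cluster_lift] provides a successor of [w] in the
    cluster of that theory. *)
Lemma truth A :
  incl (subformulas A) Sigma ->
  forall w, forces R E valuation (splitting (godel A)) w <-> mem w A.
Proof.
  induction A as [n | A IHA B IHB | A IHA B IHB | A IHA B IHB | A IHA | A IHA | A IHA];
    cbn [subformulas]; intros HS w; apply incl_cons_inv in HS as [HAB HS].
  all: try (apply incl_app_inv in HS as [HSA HSB];
    specialize (IHA HSA); specialize (IHB HSB);
    assert (HA : In A Sigma) by apply HSA, subformulas_refl;
    assert (HB : In B Sigma) by apply HSB, subformulas_refl).
  all: try (specialize (IHA HS); assert (HA : In A Sigma) by apply HS, subformulas_refl).
  all: cbn [godel splitting MBoxPlus MEx forces].
  all: assert (Hw := mem_prime w).
  - split; [tauto |]. intros H. split; [exact H |]. intros u [_ Hu]. now apply Hu.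
  - rewrite (prime_and Hw), IHA, IHB. tauto.
  - rewrite (prime_or_iff Hw), IHA, IHB. tauto.
  - split.
    + intros [H0 H]. apply NNPP. intros Hn. destruct (classic (mem w A)) as [HwA | HwA].
      * apply Hn, (prime_const Hw), IHB, H0, IHA, HwA.
      * destruct (prime_imp_witness Hw A B Hn) as (u & Hu & Hwu & HuA & HuB).
        destruct (imp_refutation w u A B) as (z & Hwz & HzA & HzB); auto.
        apply HzB, IHB, (H z Hwz), IHA, HzA.
    + intros H. split.
      * rewrite IHA, IHB. now apply (prime_mp Hw).
      * intros u [_ Hu]. rewrite IHA, IHB. apply (prime_mp (mem_prime u)). now apply Hu.
  - split.
    + intros [H0 H]. apply NNPP. intros Hn.
      destruct (prime_neg_witness Hw A Hn) as (u & Hu & Hwu & HuA).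
      rewrite IHA in H0.
      destruct (imp_refutation w u A Ibot) as (z & Hwz & HzA & _); auto using prime_bot.
      apply (H z Hwz), IHA, HzA.
    + intros H. split.
      * rewrite IHA. now apply (prime_neg Hw).
      * intros u [_ Hu]. rewrite IHA. apply (prime_neg (mem_prime u)). now apply Hu.
  - split.
    + intros [H0 H]. apply NNPP. intros Hn.
      destruct (all_refutation w A HA Hn) as (z & Hwz & HzA).
      destruct (classic (E w z)) as [HE | HE].
      * apply HzA, IHA, H0, HE.
      * destruct (cluster_lift (mem w) z Hw Hwz) as (u & Hzu & Huz & Hwu).
        apply HzA, IHA, (H u); [| now split].
        split; [| exact Hwu]. apply gains_R; [intros B HB HwB; auto |].
        intros [_ Huw]. apply HE. split; [exact Hwz | intros B HB HzB; auto].
    + intros H. split; [| intros u [[Hu _] _]]; intros z [Hz _]; apply IHA.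
      * now apply (all_E w).
      * apply (all_E u); auto. apply Hu; [now apply info_all | exact H].
  - split.
    + intros H. apply NNPP. intros Hn. apply H. intros u [_ Hu]. rewrite IHA. intros HuA.
      apply Hn, Hu; [now apply info_ex | now apply (prime_ex_T (mem_prime u))].
    + intros H Hn.
      destruct (saturated_ex_witness (mem w) A Hw H) as (u & Hwu & Huw & HuA).
      apply (Hn u); [now split | now apply IHA].
Qed.

End Model.

(** Saturating a theory that omits [A] might add [A]; one that omits [All A]
    keeps omitting it, and by [all_refutation] some world omits [A]. *)
Theorem MGL_MpIPC A : MGL (splitting (godel A)) -> MpIPC A.
Proof.
  intros H. apply NNPP. intros Hn. set (Sigma := Ibot :: subformulas A).
  assert (HA : In A Sigma) by (right; apply subformulas_refl).
  destruct (prime_extension1 (fun _ => False) (IAll A)) as (x & Hx & _ & HxA).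
  { intros Hd. apply Hn, (iclosure_mp _ (IAll A)), MpIPC_empty, Hd.
    apply (MIPC_instance A A A _ MIPC_all_T). }
  destruct (saturation Sigma x Hx) as (w & _ & Hwx).
  destruct (all_refutation Sigma w A HA) as (z & _ & HzA).
  { intros HwA. apply HxA, Hwx; [now apply info_all | exact HwA]. }
  apply HzA, (truth Sigma); [now left | now apply incl_tl |].
  apply MGL_sound; [apply model_frame | exact H].
Qed.

Theorem theorem4p12 (phi : iform) :
  (MpIPC phi <-> MpGrz (godel phi)) /\
  (MpGrz (godel phi) <-> MGL (splitting (godel phi))).
Proof.
  assert (H1 := MpIPC_MpGrz phi).
  assert (H2 := MpGrz_MGL (godel phi)).
  assert (H3 := MGL_MpIPC phi).
  tauto.
Qed.
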